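(* The category $\mathbf{OPZLC}$ of all zero-dimensional locally compact Hausdorff spaces and all open perfect maps is dually equivalent to the category $\mathbf{OGBPL}$ whose objects are all generalized Boolean pseudolattices and whose morphisms are all $\mathbf{GBPL}$-morphisms having lower preadjoints.
   Context: A space is zero-dimensional if its clopen subsets form a base. A perfect map is a continuous closed map with compact fibres. A pseudolattice is a poset having all finite non-empty meets and joins; a $\{0\}$-pseudolattice is a pseudolattice with a least element $0$. A distributive $\{0\}$-pseudolattice $A$ is a generalized Boolean pseudolattice if for all $a,b,c\in A$ with $b\le a\le c$ there exists $x\in A$ with $a\wedge x=b$ and $a\vee x=c$. A $\{0\}$-pseudolattice homomorphism preserves $0$ and binary meets and joins. The category $\mathbf{GBPL}$ has all generalized Boolean pseudolattices as objects; its morphisms $\varphi:J\to I$ are all $\{0\}$-pseudolattice homomorphisms such that for every $a\in I$ there exists $b\in J$ with $a\le\varphi(b)$. A lower preadjoint of a $\mathbf{GBPL}$-morphism $\varphi:J\to I$ is a map $\psi:I\to J$ such that (OZL1) for every $b\in J$ and every $a\in I$, $a\wedge\varphi(b)=0$ implies $\psi(a)\wedge b=0$; and (OZL2) for every $a\in I$, $\varphi(\psi(a))\ge a$. Two categories are dually equivalent if one is equivalent to the opposite of the other. *)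

(* Defs.v *)
From HB Require Import structures.
From mathcomp Require Import all_boot all_order.
From mathcomp Require Import boolp classical_sets topology.

Set Implicit Arguments.
Unset Strict Implicit.
Unset Printing Implicit Defensive.

Import Order.LTheory.

Local Open Scope classical_set_scope.

(* [comp g f] is "g after f". *)
Record category := Category {
  obj :> Type ;
  hom : obj -> obj -> Type ;
  ident : forall X, hom X X ;
  comp : forall X Y Z, hom Y Z -> hom X Y -> hom X Z ;
  comp_ident_l : forall X Y (f : hom X Y), comp (ident Y) f = f ;
  comp_ident_r : forall X Y (f : hom X Y), comp f (ident X) = f ;
  comp_assoc : forall X Y Z W (h : hom Z W) (g : hom Y Z) (f : hom X Y),
    comp h (comp g f) = comp (comp h g) f }.

Definition opposite (C : category) : category :=
  @Category C (fun X Y => hom Y X) (fun X => ident X)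
    (fun X Y Z g f => comp f g)
    (fun X Y f => comp_ident_r f) (fun X Y f => comp_ident_l f)
    (fun X Y Z W h g f => esym (comp_assoc f g h)).

Definition is_iso (C : category) (X Y : C) (f : hom X Y) : Prop :=
  exists g : hom Y X, comp g f = ident X /\ comp f g = ident Y.

Record functor (C D : category) := Functor {
  fobj :> C -> D ;
  fhom : forall X Y, hom X Y -> hom (fobj X) (fobj Y) ;
  fhom_ident : forall X, fhom (ident X) = ident (fobj X) ;
  fhom_comp : forall X Y Z (g : hom Y Z) (f : hom X Y),
    fhom (comp g f) = comp (fhom g) (fhom f) }.

Definition functor_id (C : category) : functor C C :=
  @Functor C C (fun X => X) (fun X Y f => f)
    (fun X => erefl) (fun X Y Z g f => erefl).

Definition functor_comp (C D E : category) (G : functor D E) (F : functor C D) :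
    functor C E :=
  @Functor C E (fun X => G (F X)) (fun X Y f => fhom G (fhom F f))
    (fun X => etrans (congr1 (fhom G (Y := _)) (fhom_ident F X))
                     (fhom_ident G (F X)))
    (fun X Y Z g f => etrans (congr1 (fhom G (Y := _)) (fhom_comp F g f))
                             (fhom_comp G (fhom F g) (fhom F f))).

Definition naturally_isomorphic (C D : category) (F G : functor C D) : Prop :=
  exists eta : forall X : C, hom (F X) (G X),
    (forall (X Y : C) (f : hom X Y),
       comp (fhom G f) (eta X) = comp (eta Y) (fhom F f)) /\
    (forall X : C, is_iso (eta X)).

Definition equivalent (C D : category) : Prop :=
  exists (F : functor C D) (G : functor D C),
    naturally_isomorphic (functor_comp G F) (functor_id C) /\
    naturally_isomorphic (functor_comp F G) (functor_id D).

Definition dually_equivalent (C D : category) : Prop :=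
  equivalent C (opposite D).

Section ConcreteCategory.
Context (O : Type) (carrier : O -> Type).
Context (P : forall X Y : O, (carrier X -> carrier Y) -> Prop).
Context (P_id : forall X : O, P (X := X) (Y := X) idfun).
Context (P_comp : forall (X Y Z : O) (g : carrier Y -> carrier Z)
  (f : carrier X -> carrier Y), P g -> P f -> P (g \o f)).

Let chom (X Y : O) := {f : carrier X -> carrier Y | P f}.

Let ccomp (X Y Z : O) (g : chom Y Z) (f : chom X Y) : chom X Z :=
  exist _ (sval g \o sval f) (P_comp (svalP g) (svalP f)).

Lemma concrete_hom_eq (X Y : O) (f g : {f : carrier X -> carrier Y | P f}) :
  sval f = sval g -> f = g.
Proof. by move=> /eq_sig_hprop; apply=> h p q; exact: Prop_irrelevance. Qed.

Definition concrete_category : category :=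
  @Category O chom (fun X => exist _ idfun (@P_id X)) ccomp
    (fun X Y f =>
       @concrete_hom_eq X Y (ccomp (exist _ idfun (@P_id Y)) f) f erefl)
    (fun X Y f =>
       @concrete_hom_eq X Y (ccomp f (exist _ idfun (@P_id X))) f erefl)
    (fun X Y Z W h g f =>
       @concrete_hom_eq X W (ccomp h (ccomp g f)) (ccomp (ccomp h g) f) erefl).
End ConcreteCategory.

(* The library's [zero_dimensional] only asks that distinct points be
   separated by clopen sets; here the clopen sets must form a base. *)
Definition clopen_base (X : topologicalType) : Prop := basis (@clopen X).

Definition open_map (X Y : topologicalType) (f : X -> Y) : Prop :=
  forall U : set X, open U -> open (f @` U).

Definition closed_map (X Y : topologicalType) (f : X -> Y) : Prop :=
  forall F : set X, closed F -> closed (f @` F).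

(* Perfect maps need not be surjective. *)
Definition perfect_map (X Y : topologicalType) (f : X -> Y) : Prop :=
  [/\ continuous f, closed_map f & forall y : Y, compact (f @^-1` [set y])].

Definition open_perfect_map (X Y : topologicalType) (f : X -> Y) : Prop :=
  open_map f /\ perfect_map f.

Record zlc_space := ZLCSpace {
  zlc_sort :> topologicalType ;
  zlc_clopen_base : clopen_base zlc_sort ;
  zlc_locally_compact : locally_compact [set: zlc_sort] ;
  zlc_hausdorff : hausdorff_space zlc_sort }.

Lemma open_perfect_map_id (X : topologicalType) :
  open_perfect_map (idfun : X -> X).
Proof.
split; first by move=> U; rewrite image_id.
split; [by move=> x; exact: cvg_id | by move=> F; rewrite image_id |].
by move=> y; exact: compact_set1.
Qed.

Lemma perfect_map_preimage_compact (X Y : topologicalType) (f : X -> Y)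
    (K : set Y) : perfect_map f -> compact K -> compact (f @^-1` K).
Proof.
move=> [cf clf fibf] cK F PF FK.
have [y [Ky Fy]] := cK (f @ F) (fmap_proper_filter f PF) FK.
have meetfib A : F A -> exists2 x, closure A x & f x = y.
  move=> FA; suff : (f @` closure A) y by move=> [x]; exists x.
  apply: (clf _ (@closed_closure _ A)) => B By.
  have FfA : F (f @^-1` (f @` A)).
    by apply: (filterS _ FA) => x Ax; exists x.
  have [_ [[x Ax <-] Bx]] := Fy _ _ FfA By.
  by exists (f x); split => //; exists x => //; exact: subset_closure.
pose G : set_system X :=
  filter_from F (fun A => closure A `&` f @^-1` [set y]).
have PG : ProperFilter G.
  apply: filter_from_proper; last by move=> A /meetfib [x Ax fx]; exists x.
  apply: filter_from_filter; first by exists setT; exact: filterT.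
  move=> A B FA FB; exists (A `&` B); first exact: filterI.
  by move=> x [/closureI [? ?] ?].
have Gfib : G (f @^-1` [set y]).
  by exists setT; [exact: filterT | move=> x []].
have [x [fx Gx]] := fibf y G PG Gfib.
exists x; split; first by rewrite /preimage /= fx.
move=> A B FA Bx; suff /(_ _ Bx) : closure A x by [].
apply: (@closed_closure _ A) => C Cx.
apply: Gx Cx; exists A => //; by move=> z [].
Qed.

Lemma open_perfect_map_comp (X Y Z : topologicalType) (g : Y -> Z)
    (f : X -> Y) :
  open_perfect_map g -> open_perfect_map f -> open_perfect_map (g \o f).
Proof.
move=> [og pg] [of_ pf]; have [cg clg fg] := pg; have [cf clf _] := pf.
split; first by move=> U oU; rewrite -image_comp; apply: og; exact: of_.
split.
- by move=> x; exact: continuous_comp (cf x) (cg (f x)).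
- by move=> F cF; rewrite -image_comp; apply: clg; exact: clf.
- by move=> z; exact: (perfect_map_preimage_compact pf (fg z)).
Qed.

Definition OPZLC : category :=
  @concrete_category zlc_space zlc_sort
    (fun X Y f => open_perfect_map f)
    (fun X => @open_perfect_map_id X)
    (fun X Y Z g f => @open_perfect_map_comp X Y Z g f).

(* A distributive {0}-pseudolattice is a [bDistrLatticeType]. *)
Definition generalized_boolean d (A : bDistrLatticeType d) : Prop :=
  forall a b c : A, (b <= a)%O -> (a <= c)%O ->
  exists x : A, (a `&` x)%O = b /\ (a `|` x)%O = c.

(* The display only drives the notations and carries no mathematical content;
   it is packed so that the objects do not depend on one. *)
Record gbpl := GBPLattice {
  gbpl_disp : Order.disp_t ;
  gbpl_sort :> bDistrLatticeType gbpl_disp ;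
  gbpl_generalized_boolean : generalized_boolean gbpl_sort }.

Definition gbpl_morphism (J I : gbpl) (phi : J -> I) : Prop :=
  [/\ phi \bot%O = \bot%O, Order.meet_morphism phi, Order.join_morphism phi
    & forall a : I, exists b : J, (a <= phi b)%O].

Definition lower_preadjoint (J I : gbpl) (phi : J -> I) (psi : I -> J) : Prop :=
  (forall (b : J) (a : I),
     (a `&` phi b)%O = \bot%O -> (psi a `&` b)%O = \bot%O) /\
  (forall a : I, (a <= phi (psi a))%O).

Definition ogbpl_morphism (J I : gbpl) (phi : J -> I) : Prop :=
  gbpl_morphism phi /\ exists psi : I -> J, lower_preadjoint phi psi.

Lemma ogbpl_morphism_id (I : gbpl) : ogbpl_morphism (idfun : I -> I).
Proof. by do !split => //; [move=> a; exists a | exists idfun]. Qed.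

Lemma ogbpl_morphism_comp (K J I : gbpl) (phi : J -> I) (phi' : K -> J) :
  ogbpl_morphism phi -> ogbpl_morphism phi' -> ogbpl_morphism (phi \o phi').
Proof.
move=> [[p0 pI pU pc] [psi [p1 p2]]] [[q0 qI qU qc] [psi' [q1 q2]]].
have homo_phi : {homo phi : x y / (x <= y)%O}.
  by move=> x y /meet_idPl xy; apply/meet_idPl; rewrite -pI xy.
split; first split.
- by rewrite /= q0.
- by move=> x y /=; rewrite qI pI.
- by move=> x y /=; rewrite qU pU.
- move=> a; have [b ab] := pc a; have [c bc] := qc b.
  by exists c; exact: le_trans ab (homo_phi _ _ bc).
- exists (psi' \o psi); split=> [b a /p1 /q1 //|a /=].
  exact: le_trans (p2 a) (homo_phi _ _ (q2 _)).
Qed.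

Definition OGBPL : category :=
  @concrete_category gbpl (fun I => I : Type)
    (fun J I phi => ogbpl_morphism phi)
    ogbpl_morphism_id
    (fun K J I phi phi' => @ogbpl_morphism_comp K J I phi phi').

(* Main.v *)
Require Import Defs.
From HB Require Import structures.
From mathcomp Require Import all_boot all_order.
From mathcomp Require Import boolp classical_sets topology.

Set Implicit Arguments.
Unset Strict Implicit.
Unset Printing Implicit Defensive.

Import Order.LTheory.

Local Open Scope classical_set_scope.

(** The duality is that of Stone, in its locally compact form. A space [X] goes
    to the lattice of its compact clopen sets, and a generalized Boolean
    pseudolattice [I] to its prime filters, topologized by the sets
    [basic_open a] of the prime filters containing [a]. Morphisms go to
    preimages in both directions: of compact clopen sets under a map, and of
    prime filters under a homomorphism ([pullback]).

    Relative complements make prime filters maximal, hence the spectrum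
    Hausdorff and each [basic_open a] clopen. Compactness of [basic_open a]
    holds because an ultrafilter on the spectrum induces a prime filter of [I],
    which is its limit ([compact_basic_open]). Therefore the compact clopen
    sets of the spectrum are exactly the sets [basic_open a]
    ([compact_open_basic]), and Zorn's lemma supplies enough prime filters for
    [a] to be recovered from [basic_open a] ([prime_filter_separation]). This
    identifies [I] with the algebra of its spectrum. Conversely the compact
    clopen sets are a base of a zero-dimensional locally compact Hausdorff
    space, so its points are separated by them, and a prime filter of them has
    by compactness a cluster point, which is the only point of all its members
    ([point_filter_surj]).

    On morphisms, the cofinality condition on a homomorphism makes the pullback
    of a prime filter nonempty; the preimages of compact sets are then compact,
    which in locally compact Hausdorff spaces is perfectness
    ([proper_perfect_map]). Lower preadjoints account for openness: for an open
    perfect map [f] the direct image along [f] is a lower preadjoint of the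
    preimage homomorphism, and a lower preadjoint [psi] of [phi] satisfies
    [pullback @` basic_open a = basic_open (psi a)] ([pullback_basic_open]), so
    that the pullback along [phi] is an open map. *)

(** * Isomorphisms *)

(** Symmetry lets the unit of the duality be built in the direction in which it
    has an explicit formula, from a space to the spectrum of its algebra. *)
Lemma naturally_isomorphic_sym (C D : category) (F G : functor C D) :
  naturally_isomorphic F G -> naturally_isomorphic G F.
Proof.
move=> [eta [nat_eta iso_eta]].
pose theta X := sval (cid (iso_eta X)).
have thetaP X := svalP (cid (iso_eta X)); rewrite -/(theta _) in thetaP.
exists theta; split=> [X Y f|X]; last first.
  by exists (eta X); have [? ?] := thetaP X; split.
have [thetaK _] := thetaP Y; have [_ etaK] := thetaP X.
rewrite -[LHS]comp_ident_l -thetaK -!comp_assoc (comp_assoc (eta Y)) -nat_eta.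
by rewrite -!comp_assoc etaK comp_ident_r.
Qed.

Lemma homeomorphism_open_perfect (X Y : topologicalType) (f : X -> Y)
    (g : Y -> X) :
  cancel f g -> cancel g f -> continuous f -> continuous g ->
  open_perfect_map f.
Proof.
move=> fK gK cf cg.
have imE U : f @` U = g @^-1` U.
  apply/seteqP; split=> [_ [x Ux <-]|y Uy]; first by rewrite /preimage /= fK.
  by exists (g y).
split; first by move=> U oU; rewrite imE; move/continuousP: cg; apply.
split=> // [F cF|y].
  by rewrite imE; move/continuous_closedP: cg; apply.
suff -> : f @^-1` [set y] = [set g y] by exact: compact_set1.
by apply/seteqP; split=> [x <-|x ->]; rewrite /preimage /= ?fK ?gK.
Qed.

(** The inverse of an order isomorphism is a lower preadjoint of it. *)
Lemma order_isomorphism_ogbpl (J I : gbpl) (f : J -> I) (g : I -> J) :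
  cancel f g -> cancel g f -> {mono f : x y / (x <= y)%O} -> ogbpl_morphism f.
Proof.
move=> fK gK fle.
have gle : {mono g : x y / (x <= y)%O} by move=> x y; rewrite -fle !gK.
have f0 : f \bot%O = \bot%O by apply/eqP; rewrite -lex0 -(gK \bot%O) fle le0x.
have fI : Order.meet_morphism f.
  move=> x y; apply/eqP; rewrite eq_le lexI !fle leIl leIr /=.
  by rewrite -[X in (X <= _)%O]gK fle lexI -!(fle (g _)) gK leIl leIr.
split; first split=> //.
- move=> x y; apply/eqP; rewrite eq_le leUx !fle leUl leUr !andbT.
  by rewrite -[X in (_ <= X)%O]gK fle leUx -!(fle _ (g _)) gK leUl leUr.
- by move=> a; exists (g a); rewrite gK.
- exists g; split=> [b a|a]; last by rewrite gK.
  by move=> ab0; apply: (can_inj fK); rewrite fI gK ab0 f0.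
Qed.

(** * Prime filters *)

Record prime_filter d (A : bDistrLatticeType d) := PrimeFilter {
  prime_mem :> A -> Prop ;
  prime_inhabited : exists a, prime_mem a ;
  prime_bot : ~ prime_mem \bot%O ;
  prime_meet : forall a b,
    prime_mem (a `&` b)%O <-> prime_mem a /\ prime_mem b ;
  prime_join : forall a b,
    prime_mem (a `|` b)%O <-> prime_mem a \/ prime_mem b }.

Section PrimeFilter.
Context d (A : bDistrLatticeType d).
Implicit Types (a b c : A) (P Q : prime_filter A).

Lemma prime_filter_ext P Q : (forall a, P a <-> Q a) -> P = Q.
Proof.
case: P Q => [P P1 P2 P3 P4] [Q Q1 Q2 Q3 Q4] /= PQ.
have {}PQ : P = Q by apply/funext => a; exact/propext.
rewrite -{}PQ in Q1 Q2 Q3 Q4 *.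
by congr PrimeFilter; exact: Prop_irrelevance.
Qed.

Lemma prime_up P a b : (a <= b)%O -> P a -> P b.
Proof. by move=> /join_idPl <- Pa; apply/prime_join; right. Qed.

(** By distributivity, an ideal that is maximal among those containing [b] and
    not [a] has a prime filter as its complement. The family handed to Zorn's
    lemma has to contain the empty union, so it consists of the possibly empty
    ideals [S] such that [a] is not below any [s `|` b]; maximality then puts
    [b] into [S]. *)
Lemma prime_filter_separation a b :
  ~ (a <= b)%O -> exists P, P a /\ ~ P b.
Proof.
move=> nab.
pose Avoids (S : set A) :=
  [/\ forall s t, S s -> S t -> S (s `|` t)%O,
      forall s t, (s <= t)%O -> S t -> S s &
      forall s, S s -> ~ (a <= s `|` b)%O].
have [F FA Ftot|S [[SU Sdown Sa] Smax]] := @Zorn_bigcup A Avoids.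
  split.
  - move=> s t [X FX Xs] [Y FY Yt].
    have [/(_ _ Xs) Ys|/(_ _ Yt) Xt] := Ftot _ _ FX FY.
      by exists Y => //; have [+ _ _] := FA _ FY; apply.
    by exists X => //; have [+ _ _] := FA _ FX; apply.
  - move=> s t st [X FX Xt]; exists X => //.
    by have [_ + _] := FA _ FX; apply; [exact: st|].
  - by move=> s [X FX Xs]; have [_ _] := FA _ FX; apply.
(* Maximality, applied to the ideal generated by [S] and [c]; the alternative
   [s = \bot] covers the case of an empty [S]. *)
have extend c : ~ S c ->
    exists s, (S s \/ s = \bot%O) /\ (a <= s `|` c `|` b)%O.
  move=> nSc; apply: contrapT => no.
  pose T := [set y | exists s, (S s \/ s = \bot%O) /\ (y <= s `|` c)%O].
  apply: (Smax T).
    split=> [s Ss|TS]; first by exists s; split; [left|rewrite leUl].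
    by apply/nSc/TS; exists \bot%O; split; [right|rewrite join0x].
  split.
  - move=> y z [s [Ss ys]] [t [St zt]]; exists (s `|` t)%O; split.
      case: Ss St => [Ss|->] [St|->]; rewrite ?join0x ?joinx0.
      + by left; exact: SU.
      + by left.
      + by left.
      + by right.
    rewrite leUx (le_trans ys) ?(le_trans zt) //.
      by rewrite leU2 // leUr.
    by rewrite leU2 // leUl.
  - by move=> y z yz [s [Ss zs]]; exists s; split=> //; exact: le_trans zs.
  - move=> y [s [Ss ys]] ay; apply: no; exists s; split=> //.
    by apply: le_trans ay _; rewrite leU2.
have Sb : S b.
  apply: contrapT => /extend [s [Ss]]; rewrite -joinA joinxx.
  by case: Ss => [/Sa //|->]; rewrite join0x.
have below c : ~ S c -> exists s, S s /\ (a <= s `|` c)%O.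
  move=> /extend [s [Ss asc]]; exists (s `|` b)%O; split.
    by case: Ss => [Ss|->]; [exact: SU|rewrite join0x].
  by rewrite joinAC.
have nSa : ~ S a by move=> /Sa; rewrite leUl.
have P1 : exists c, ~ S c by exists a.
have P2 : ~ ~ S \bot%O by move=> /(_ (Sdown _ _ (le0x b) Sb)).
have P3 x y : ~ S (x `&` y)%O <-> ~ S x /\ ~ S y.
  split=> [nS|[/below[s [Ss asx]] /below[t [St aty]]] Sxy].
    by split=> ?; apply: nS; [apply: (Sdown _ x)|apply: (Sdown _ y)];
      rewrite ?leIl ?leIr.
  apply/nSa/(Sdown _ (s `|` t `|` (x `&` y))%O); last exact/SU/Sxy/SU.
  rewrite joinIr lexI (le_trans asx) ?(le_trans aty) //.
    by rewrite leU2 // leUr.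
  by rewrite leU2 // leUl.
have P4 x y : ~ S (x `|` y)%O <-> ~ S x \/ ~ S y.
  split=> [nS|nSxy Sxy].
    by apply/not_andP => -[Sx Sy]; exact/nS/SU.
  by case: nSxy; apply; apply: Sdown Sxy; rewrite ?leUl ?leUr.
by exists (PrimeFilter P1 P2 P3 P4); split=> //=; exact.
Qed.

(** * The spectrum *)

HB.instance Definition _ := gen_eqMixin (prime_filter A).
HB.instance Definition _ := gen_choiceMixin (prime_filter A).

Definition basic_open a : set (prime_filter A) := [set P | P a].

Definition spectrum_open (U : set (prime_filter A)) :=
  forall P, U P -> exists2 a, P a & basic_open a `<=` U.

Lemma spectrum_openT : spectrum_open setT.
Proof. by move=> P _; have [a Pa] := prime_inhabited P; exists a. Qed.

Lemma spectrum_openI : setI_closed spectrum_open.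
Proof.
move=> U V oU oV P [/oU[a Pa aU] /oV[b Pb bV]].
exists (a `&` b)%O; first exact/prime_meet.
by move=> Q /prime_meet[/aU ? /bV].
Qed.

Lemma spectrum_open_bigcup (I : Type) (f : I -> set (prime_filter A)) :
  (forall i, spectrum_open (f i)) -> spectrum_open (\bigcup_i f i).
Proof.
move=> of_ P [i _ /of_[a Pa af]]; exists a => //.
by move=> Q /af fQ; exists i.
Qed.

HB.instance Definition _ := isOpenTopological.Build (prime_filter A)
  spectrum_openT spectrum_openI spectrum_open_bigcup.

Lemma open_basic_open a : open (basic_open a).
Proof. by move=> P Pa; exists a. Qed.

Lemma nbhs_basic_open P a : P a -> nbhs P (basic_open a).
Proof.
by move=> Pa; apply: open_nbhs_nbhs; split=> //; exact: open_basic_open.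
Qed.

Lemma basic_open_nbhs P (U : set (prime_filter A)) :
  nbhs P U -> exists2 a, P a & basic_open a `<=` U.
Proof.
rewrite nbhsE => -[V [oV VP] VU]; have [a Pa aV] := oV _ VP.
by exists a => //; exact: subset_trans VU.
Qed.

Lemma basic_openI a b :
  basic_open (a `&` b)%O = basic_open a `&` basic_open b.
Proof. by apply/seteqP; split=> P /prime_meet. Qed.

Lemma basic_openU a b :
  basic_open (a `|` b)%O = basic_open a `|` basic_open b.
Proof. by apply/seteqP; split=> P /prime_join. Qed.

Lemma basic_open_le a b : basic_open a `<=` basic_open b <-> (a <= b)%O.
Proof.
split=> [ab|/prime_up ab P]; last exact: ab.
by apply: contrapT => /prime_filter_separation[P [/ab]].
Qed.

Lemma basic_open_eq0 a : basic_open a `<=` set0 -> a = \bot%O.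
Proof.
by move=> a0; apply/eqP; rewrite -lex0; apply/basic_open_le => P /a0.
Qed.

(** An ultrafilter on the spectrum traces on the lattice a prime filter, to
    which it converges. *)
Lemma compact_basic_open a : compact (basic_open a).
Proof.
rewrite compact_ultra => F UF Fa.
have PF : ProperFilter F := ultra_proper.
have P2 : ~ F (basic_open \bot%O).
  move=> F0; apply: (@filter_not_empty _ F).
  by apply: filterS F0 => P /prime_bot.
have P3 b c : F (basic_open (b `&` c)%O) <->
    F (basic_open b) /\ F (basic_open c).
  rewrite basic_openI; split=> [FI|[Fb Fc]]; last exact: filterI.
  by split; apply: filterS FI => P [].
have P4 b c : F (basic_open (b `|` c)%O) <->
    F (basic_open b) \/ F (basic_open c).
  rewrite basic_openU; split=> [FU|[]]; last 2 first.
  - by apply: filterS => P; left.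
  - by apply: filterS => P; right.
  have [|FbC] := in_ultra_setVsetC (basic_open b) UF; first by left.
  by right; apply: filterS (filterI FU FbC) => P [[]].
pose P := PrimeFilter (ex_intro _ a Fa) P2 P3 P4.
exists P; split=> // U /basic_open_nbhs[b Fb bU].
exact: filterS bU Fb.
Qed.

(** The basic sets inside [U] form a cover of [U] that is directed, because
    [basic_open] turns joins into unions; by compactness one of them is [U]. *)
Lemma compact_open_basic (U : set (prime_filter A)) :
  compact U -> open U -> exists a, U = basic_open a.
Proof.
move=> cU oU.
pose below := [set a | basic_open a `<=` U].
(* The tails of the directed set [below] generate [F]. *)
pose F := filter_from below (fun a => [set c | below c /\ (a <= c)%O]).
have FF : Filter F.
  apply: filter_from_filter; first by exists \bot%O => P /prime_bot.
  move=> a b aU bU; exists (a `|` b)%O.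
    by rewrite /below /= basic_openU => P [/aU|/bU].
  by move=> c [cbU]; rewrite leUx => /andP[].
have [|a aU /(_ a)] :=
    (compact_near_coveringP U).1 cU _ F (fun c P => basic_open c P) FF.
  move=> P /oU[a Pa aU].
  exists (basic_open a, [set c | below c /\ (a <= c)%O]).
    by split=> /=; [exact: nbhs_basic_open|exists a].
  by move=> [Q c] /= [Qa [_ ac]]; exact: prime_up Qa.
by move=> /(_ (conj aU (lexx a))) Ua; exists a; apply/seteqP.
Qed.

End PrimeFilter.
Section GeneralizedBooleanSpectrum.
Context d (A : bDistrLatticeType d) (gbA : generalized_boolean A).
Implicit Types (a b c : A) (P Q : prime_filter A).

(** Outside [basic_open a], a prime filter containing [b] contains the
    complement of [a] relative to [b]. *)
Lemma prime_filter_disjoint P a :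
  ~ P a -> exists2 x, P x & (a `&` x)%O = \bot%O.
Proof.
move=> nPa; have [b Pb] := prime_inhabited P.
have [x [abx abxb]] := gbA (le0x (a `&` b)%O) (leIr b a).
have xb : (x <= b)%O by rewrite -abxb leUr.
exists x; last by rewrite -abx -meetA (meet_idPr xb).
by move: Pb; rewrite -[in P _]abxb prime_join prime_meet => -[[]|].
Qed.

Lemma closed_basic_open a : closed (basic_open a).
Proof.
rewrite -openC; suff : spectrum_open (~` basic_open a) by [].
move=> P /prime_filter_disjoint[x Px ax0]; exists x => //.
move=> Q Qx Qa; apply: (@prime_bot _ _ Q).
by rewrite -ax0; apply/prime_meet.
Qed.

Lemma clopen_basic_open a : clopen (basic_open a).
Proof. by split; [exact: open_basic_open|exact: closed_basic_open]. Qed.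

Lemma spectrum_clopen_base : clopen_base (prime_filter A).
Proof.
split=> [U []//|P U /basic_open_nbhs[a Pa aU]].
by exists (basic_open a) => //; split=> //; exact: clopen_basic_open.
Qed.

Lemma spectrum_locally_compact : locally_compact [set: prime_filter A].
Proof.
move=> P _; have [a Pa] := prime_inhabited P.
exists (basic_open a).
  by rewrite withinET; exact: nbhs_basic_open.
by split; [exact: compact_basic_open|exact: closed_basic_open].
Qed.

(** Distinct prime filters are incomparable since relative complements make
    prime filters maximal. *)
Lemma prime_filter_incl_eq P Q : (forall a, P a -> Q a) -> P = Q.
Proof.
move=> PQ; apply: prime_filter_ext => a; split=> [/PQ //|Qa].
apply: contrapT => /prime_filter_disjoint[x /PQ Qx ax0].
by apply: (@prime_bot _ _ Q); rewrite -ax0; apply/prime_meet.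
Qed.

Lemma spectrum_hausdorff : hausdorff_space (prime_filter A).
Proof.
move=> P Q PQ; apply: prime_filter_incl_eq => a Pa.
apply: contrapT => nQa.
have /PQ : nbhs P (basic_open a) by exact: nbhs_basic_open.
have nbhsQ : nbhs Q (~` basic_open a).
  by apply: open_nbhs_nbhs; split=> //; exact/closed_openC/closed_basic_open.
by move=> /(_ _ nbhsQ) [R []].
Qed.

End GeneralizedBooleanSpectrum.

Definition spectrum (I : gbpl) : zlc_space :=
  ZLCSpace (spectrum_clopen_base (@gbpl_generalized_boolean I))
    (spectrum_locally_compact (@gbpl_generalized_boolean I))
    (spectrum_hausdorff (@gbpl_generalized_boolean I)).

(** * The algebra of compact clopen sets *)

Record compact_clopen (X : topologicalType) := CompactClopen {
  compact_clopen_set :> set X ;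
  compact_clopen_compact : compact compact_clopen_set ;
  compact_clopen_clopen : clopen compact_clopen_set }.

Arguments compact_clopen_compact {X} c.
Arguments compact_clopen_clopen {X} c.

Section CompactClopen.
Context (X : topologicalType).
Implicit Types K L M : compact_clopen X.

Lemma compact_clopen_inj K L : (K : set X) = L -> K = L.
Proof.
case: K L => [K K1 K2] [L L1 L2] /= KL; rewrite -{}KL in L1 L2 *.
by congr CompactClopen; exact: Prop_irrelevance.
Qed.

HB.instance Definition _ := gen_eqMixin (compact_clopen X).
HB.instance Definition _ := gen_choiceMixin (compact_clopen X).

Definition compact_clopenI K L : compact_clopen X :=
  CompactClopen
    (compact_closedI (compact_clopen_compact K)
       (proj2 (compact_clopen_clopen L)))
    (clopenI (compact_clopen_clopen K) (compact_clopen_clopen L)).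

Definition compact_clopenU K L : compact_clopen X :=
  CompactClopen
    (compactU (compact_clopen_compact K) (compact_clopen_compact L))
    (clopenU (compact_clopen_clopen K) (compact_clopen_clopen L)).

Definition compact_clopen0 : compact_clopen X :=
  CompactClopen (@compact0 X) (@clopen0 X).

Definition compact_clopenD K L : compact_clopen X :=
  CompactClopen
    (compact_closedI (compact_clopen_compact K)
       (open_closedC (proj1 (compact_clopen_clopen L))))
    (clopenI (compact_clopen_clopen K)
       (clopenC setT (compact_clopen_clopen L))).

Definition compact_clopen_le K L : bool := `[< (K : set X) `<=` L >].

Lemma compact_clopen_leE K L :
  compact_clopen_le K L = (compact_clopenI K L == K).
Proof.
apply/asboolP/eqP => [/setIidPl KL|<-]; first exact: compact_clopen_inj.
exact: subIsetr.
Qed.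

Lemma compact_clopenIC : commutative compact_clopenI.
Proof. by move=> K L; apply: compact_clopen_inj; exact: setIC. Qed.

Lemma compact_clopenUC : commutative compact_clopenU.
Proof. by move=> K L; apply: compact_clopen_inj; exact: setUC. Qed.

Lemma compact_clopenIA : associative compact_clopenI.
Proof. by move=> K L M; apply: compact_clopen_inj; exact: setIA. Qed.

Lemma compact_clopenUA : associative compact_clopenU.
Proof. by move=> K L M; apply: compact_clopen_inj; exact: setUA. Qed.

Lemma compact_clopenUKI L K : compact_clopenI K (compact_clopenU K L) = K.
Proof. by apply: compact_clopen_inj; rewrite /= setUC setKU. Qed.

Lemma compact_clopenIKU L K : compact_clopenU K (compact_clopenI K L) = K.
Proof. by apply: compact_clopen_inj; rewrite /= setIC setKI. Qed.

Lemma compact_clopenIUl : left_distributive compact_clopenI compact_clopenU.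
Proof. by move=> K L M; apply: compact_clopen_inj; exact: setIUl. Qed.

Lemma compact_clopenII : idempotent_op compact_clopenI.
Proof. by move=> K; apply: compact_clopen_inj; exact: setIid. Qed.

HB.instance Definition _ :=
  Order.isMeetJoinDistrLattice.Build set_display (compact_clopen X)
    compact_clopen_leE (fun _ _ => erefl) compact_clopenIC compact_clopenUC
    compact_clopenIA compact_clopenUA compact_clopenUKI compact_clopenIKU
    compact_clopenIUl compact_clopenII.

Lemma compact_clopen_le0 K : (compact_clopen0 <= K)%O.
Proof. by apply/asboolP; exact: sub0set. Qed.

HB.instance Definition _ :=
  Order.hasBottom.Build set_display (compact_clopen X) compact_clopen_le0.

Lemma compact_clopen_leP K L : reflect ((K : set X) `<=` L) (K <= L)%O.
Proof. exact: asboolP. Qed.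

Lemma compact_clopen_generalized_boolean :
  generalized_boolean (compact_clopen X).
Proof.
move=> K L M /compact_clopen_leP LK /compact_clopen_leP KM.
exists (compact_clopenU L (compact_clopenD M K)).
split; apply: compact_clopen_inj; apply/seteqP; split=> x /=.
- by move=> [? [|[]]].
- by move=> Lx; split; [exact: LK|left].
- by move=> [/KM|[/LK/KM|[]]].
- by move=> Mx; have [|nKx] := pselect ((K : set X) x); [left|right; right].
Qed.

End CompactClopen.

Definition compact_clopen_gbpl (X : topologicalType) : gbpl :=
  GBPLattice (@compact_clopen_generalized_boolean X).

Lemma compact_clopen_base (X : zlc_space) (x : X) (U : set X) :
  nbhs x U ->
  exists K : compact_clopen X, (K : set X) x /\ (K : set X) `<=` U.
Proof.
move=> Ux; have [W + [cW _]] := @zlc_locally_compact X x I.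
rewrite withinET => Wx.
have [_ baseX] := zlc_clopen_base X.
have [V [cV Vx] VUW] := baseX x _ (filterI Ux Wx).
have cptV : compact V.
  by apply: (subclosed_compact cV.2 cW) => y /VUW[].
by exists (CompactClopen cptV cV); split=> // y /VUW[].
Qed.

(** Closedness of [f @` F] can be tested near each point, on a compact clopen
    neighbourhood [K]; there it holds since [F `&` f @^-1` K] is compact. *)
Lemma proper_perfect_map (X : topologicalType) (Y : zlc_space) (f : X -> Y) :
  continuous f ->
  (forall K : compact_clopen Y, compact (f @^-1` K)) -> perfect_map f.
Proof.
move=> cf pf; split=> // [F cF y Fy|y].
- have [K [Ky _]] := compact_clopen_base (@filterT _ (nbhs y) _).
  have cfK : closed (f @` (F `&` f @^-1` K)).
    apply: compact_closed; first exact: zlc_hausdorff.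
    apply: continuous_compact; first exact: continuous_subspaceT.
    by rewrite setIC; exact: compact_closedI.
  suff /cfK [x [Fx _] <-] : closure (f @` (F `&` f @^-1` K)) y by exists x.
  have nK : nbhs y K.
    by apply: open_nbhs_nbhs; split=> //; exact: (compact_clopen_clopen K).1.
  move=> B By; have [_ [[x Fx <-] [Bx Kx]]] := Fy _ (filterI By nK).
  by exists (f x); split=> //; exists x.
- have [K [Ky _]] := compact_clopen_base (@filterT _ (nbhs y) _).
  apply: subclosed_compact (pf K) _; last by move=> x /= ->.
  move/continuous_closedP: cf; apply.
  by apply: compact_closed; [exact: zlc_hausdorff|exact: compact_set1].
Qed.
(** * The two functors *)

Definition preimage_compact_clopen (X Y : topologicalType) (f : X -> Y)
    (pf : open_perfect_map f) (K : compact_clopen Y) : compact_clopen X :=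
  CompactClopen
    (perfect_map_preimage_compact pf.2 (compact_clopen_compact K))
    (preimage_clopen (compact_clopen_clopen K)
       (let: conj _ (And3 cf _ _) := pf in cf)).

(** Taking images along an open map is left adjoint to taking preimages, so it
    is a lower preadjoint; Hausdorffness of [Y] makes the images closed. *)
Lemma preimage_ogbpl_morphism (X : topologicalType) (Y : zlc_space)
    (f : X -> Y) (pf : open_perfect_map f) :
  @ogbpl_morphism (compact_clopen_gbpl Y) (compact_clopen_gbpl X)
    (preimage_compact_clopen pf).
Proof.
have [of_ [cf _ _]] := pf.
have cfK (K : compact_clopen X) : compact (f @` K).
  apply: continuous_compact (compact_clopen_compact K).
  exact: continuous_subspaceT.
have clfK (K : compact_clopen X) : clopen (f @` K).
  split; first by apply: of_; exact: (compact_clopen_clopen K).1.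
  by apply: compact_closed; [exact: zlc_hausdorff|exact: cfK].
pose image K : compact_clopen Y := CompactClopen (cfK K) (clfK K).
have imageP (K : compact_clopen X) :
    (K <= preimage_compact_clopen pf (image K))%O.
  by apply/compact_clopen_leP => x Kx; exists x.
split; first split=> //.
- exact: compact_clopen_inj.
- by move=> K L; exact: compact_clopen_inj.
- by move=> K L; exact: compact_clopen_inj.
- by move=> K; exists (image K); exact: imageP.
exists image; split=> [L K KL|K]; last exact: imageP.
apply: compact_clopen_inj; apply/seteqP; split=> // _ [[x Kx <-] Lfx].
have : (Order.meet K (preimage_compact_clopen pf L) : set X) x by [].
by rewrite KL.
Qed.

Section Pullback.
Context (J I : gbpl) (phi : J -> I) (phiP : ogbpl_morphism phi).

Lemma pullback_inhabited (P : prime_filter I) : exists b, P (phi b).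
Proof.
have [[_ _ _ cofinal] _] := phiP; have [a Pa] := prime_inhabited P.
by have [b ab] := cofinal a; exists b; exact: prime_up ab Pa.
Qed.

Lemma pullback_bot (P : prime_filter I) : ~ P (phi \bot%O).
Proof. by have [[-> _ _ _] _] := phiP; exact: prime_bot. Qed.

Lemma pullback_meet (P : prime_filter I) a b :
  P (phi (a `&` b)%O) <-> P (phi a) /\ P (phi b).
Proof. by have [[_ -> _ _] _] := phiP; exact: prime_meet. Qed.

Lemma pullback_join (P : prime_filter I) a b :
  P (phi (a `|` b)%O) <-> P (phi a) \/ P (phi b).
Proof. by have [[_ _ -> _] _] := phiP; exact: prime_join. Qed.

Definition pullback (P : prime_filter I) : prime_filter J :=
  PrimeFilter (pullback_inhabited P) (@pullback_bot P) (pullback_meet P)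
    (pullback_join P).

Lemma pullback_continuous : continuous pullback.
Proof.
move=> P U /basic_open_nbhs[b Pb bU].
apply: filterS (@nbhs_basic_open _ I P (phi b) Pb).
by move=> Q Qb; apply: bU.
Qed.

Lemma pullback_perfect : @perfect_map (spectrum I) (spectrum J) pullback.
Proof.
apply: proper_perfect_map; first exact: pullback_continuous.
move=> K.
have [b ->] :=
  compact_open_basic (compact_clopen_compact K) (compact_clopen_clopen K).1.
exact: (@compact_basic_open _ I (phi b)).
Qed.

(** The image of [basic_open a] is closed, so a prime filter [Q] outside of it
    contains some [b] with [basic_open (phi b)] disjoint from [basic_open a];
    then [b] is disjoint from [psi a] by the first axiom of preadjoints. The
    second axiom gives the other inclusion. *)
Lemma pullback_basic_open (psi : I -> J) (a : I) :
  lower_preadjoint phi psi -> pullback @` basic_open a = basic_open (psi a).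
Proof.
move=> [disj psi_le]; apply/seteqP; split=> [_ [P Pa <-]|Q Qa].
  exact: prime_up (psi_le a) Pa.
have [_ closed_pullback _] := pullback_perfect.
have closed_im : closed (pullback @` basic_open a).
  exact/closed_pullback/(closed_basic_open (@gbpl_generalized_boolean I)).
apply: closed_im => B /basic_open_nbhs[b Qb bB].
apply: contrapT => no.
have ab0 : (a `&` phi b)%O = \bot%O.
  apply: basic_open_eq0; rewrite basic_openI => P [Pa Pb]; apply: no.
  by exists (pullback P); split; [exists P|exact: bB].
apply: (@prime_bot _ _ Q); rewrite -(disj _ _ ab0).
exact/prime_meet.
Qed.

Lemma pullback_open_perfect :
  @open_perfect_map (spectrum I) (spectrum J) pullback.
Proof.
split; last exact: pullback_perfect.
have [_ [psi psiP]] := phiP.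
move=> U oU; suff : spectrum_open (pullback @` U) by [].
move=> _ [P /oU[a Pa aU] <-]; exists (psi a).
  exact: prime_up (psiP.2 a) Pa.
rewrite -pullback_basic_open // => _ [Q /aU UQ <-].
by exists Q.
Qed.

End Pullback.

Definition compact_clopen_hom (X Y : OPZLC) (f : hom X Y) :
    @hom (opposite OGBPL) (compact_clopen_gbpl X) (compact_clopen_gbpl Y) :=
  exist _ _ (preimage_ogbpl_morphism (svalP f)).

Lemma compact_clopen_hom_ident (X : OPZLC) :
  compact_clopen_hom (ident X) = ident _.
Proof.
by apply: concrete_hom_eq; apply/funext => K; exact: compact_clopen_inj.
Qed.

Lemma compact_clopen_hom_comp (X Y Z : OPZLC) (g : hom Y Z) (f : hom X Y) :
  compact_clopen_hom (Defs.comp g f) =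
  Defs.comp (compact_clopen_hom g) (compact_clopen_hom f).
Proof.
by apply: concrete_hom_eq; apply/funext => K; exact: compact_clopen_inj.
Qed.

Definition compact_clopen_functor : functor OPZLC (opposite OGBPL) :=
  @Functor OPZLC (opposite OGBPL) (fun X => compact_clopen_gbpl X)
    compact_clopen_hom compact_clopen_hom_ident compact_clopen_hom_comp.

Definition spectrum_hom (I J : opposite OGBPL) (phi : hom I J) :
    @hom OPZLC (spectrum I) (spectrum J) :=
  exist _ _ (pullback_open_perfect (svalP phi)).

Lemma spectrum_hom_ident (I : opposite OGBPL) :
  spectrum_hom (ident I) = ident _.
Proof.
by apply: concrete_hom_eq; apply/funext => P; exact: prime_filter_ext.
Qed.

Lemma spectrum_hom_comp (I J K : opposite OGBPL) (g : hom J K) (f : hom I J) :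
  spectrum_hom (Defs.comp g f) = Defs.comp (spectrum_hom g) (spectrum_hom f).
Proof.
by apply: concrete_hom_eq; apply/funext => P; exact: prime_filter_ext.
Qed.

Definition spectrum_functor : functor (opposite OGBPL) OPZLC :=
  @Functor (opposite OGBPL) OPZLC (fun I => spectrum I)
    spectrum_hom spectrum_hom_ident spectrum_hom_comp.

(** * A space is the spectrum of its algebra *)

Section PointFilter.
Context (X : zlc_space).
Local Notation KX := (compact_clopen_gbpl X).

Lemma point_inhabited (x : X) : exists K : compact_clopen X, (K : set X) x.
Proof.
have [K [Kx _]] := compact_clopen_base (@filterT _ (nbhs x) _).
by exists K.
Qed.

Definition point_filter (x : X) : prime_filter KX :=
  @PrimeFilter _ KX (fun K : compact_clopen X => (K : set X) x)
    (point_inhabited x) id (fun _ _ => iff_refl _) (fun _ _ => iff_refl _).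

Lemma point_filter_inj : injective point_filter.
Proof.
move=> x y xy; apply: zlc_hausdorff => U V /compact_clopen_base[K [Kx KU]] Vy.
have Ky : (K : set X) y.
  by move: Kx; rewrite -[_ x]/(prime_mem (point_filter x) K) xy.
by exists y; split; [exact: KU|exact: nbhs_singleton].
Qed.

(** By compactness of one of its members, a prime filter of compact clopen sets
    clusters at some point [x]. Its members are closed, so they contain [x],
    and it is maximal. *)
Lemma point_filter_surj (P : prime_filter KX) : exists x, point_filter x = P.
Proof.
have [K PK] := prime_inhabited P.
pose F := filter_from [set L : compact_clopen X | P L] (fun L => L : set X).
have PF : ProperFilter F.
  apply: filter_from_proper.
    apply: filter_from_filter; first by exists K.
    by move=> L M PL PM; exists (compact_clopenI L M) => //; exact/prime_meet.
  move=> L PL; apply: contrapT => L0.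
  apply: (@prime_bot _ _ P); suff <- : L = \bot%O by [].
  apply: compact_clopen_inj; apply/seteqP; split=> // x Lx.
  by apply: L0; exists x.
have [|x [_ Fx]] := compact_clopen_compact K F PF; first by exists K.
exists x; apply/esym/prime_filter_incl_eq.
  exact: compact_clopen_generalized_boolean.
move=> L PL; apply: (compact_clopen_clopen L).2 => B Bx.
by apply: Fx Bx; exists L.
Qed.

Lemma point_filter_continuous :
  continuous (point_filter : X -> spectrum KX).
Proof.
move=> x U /basic_open_nbhs[K Kx KU].
have nK : nbhs x K.
  by apply: open_nbhs_nbhs; split=> //; exact: (compact_clopen_clopen K).1.
by apply: filterS nK => y Ky; exact: KU.
Qed.

Lemma point_filter_inverse_continuous (g : spectrum KX -> X) :
  cancel g point_filter -> continuous g.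
Proof.
move=> gK P U /compact_clopen_base[K [KgP KU]].
have nK : nbhs P (basic_open (K : KX)).
  by apply: nbhs_basic_open; rewrite -(gK P).
apply: filterS nK => Q QK; apply: KU.
by rewrite -[_ (g Q)]/(prime_mem (point_filter (g Q)) K) gK.
Qed.

End PointFilter.

Lemma spectrum_compact_clopen :
  naturally_isomorphic (functor_id OPZLC)
    (functor_comp spectrum_functor compact_clopen_functor).
Proof.
have inv (X : zlc_space) : exists g, cancel g (@point_filter X).
  by have [g gK] := choice (@point_filter_surj X); exists g.
have homeo (X : zlc_space) g : cancel g (@point_filter X) ->
    cancel (@point_filter X) g /\
    @open_perfect_map X (spectrum (compact_clopen_gbpl X)) (@point_filter X) /\
    @open_perfect_map (spectrum (compact_clopen_gbpl X)) X g.
  move=> gK.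
  have fK : cancel (@point_filter X) g.
    by move=> x; apply: point_filter_inj; rewrite gK.
  have cg := point_filter_inverse_continuous gK.
  have cf := @point_filter_continuous X.
  by do 2 split=> //; [exact: homeomorphism_open_perfect fK gK cf cg|
    exact: homeomorphism_open_perfect gK fK cg cf].
have eta_open_perfect (X : zlc_space) :
    open_perfect_map (@point_filter X : X -> spectrum _).
  by have [g /homeo[_ []]] := inv X.
exists (fun X => exist _ _ (eta_open_perfect X)); split=> [X Y f|X].
  by apply: concrete_hom_eq; apply/funext => x; exact: prime_filter_ext.
have [g gK] := inv X; have [fK [_ opg]] := homeo _ _ gK.
exists (exist _ g opg).
by split; apply: concrete_hom_eq; apply/funext => x; [exact: fK|exact: gK].
Qed.

(** * A generalized Boolean pseudolattice is the algebra of its spectrum *)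

Section BasicCompactClopen.
Context (I : gbpl).

Definition basic_compact_clopen (a : I) : compact_clopen (spectrum I) :=
  CompactClopen (@compact_basic_open _ I a)
    (clopen_basic_open (@gbpl_generalized_boolean I) a).

Lemma basic_compact_clopen_mono :
  {mono basic_compact_clopen : a b / (a <= b)%O}.
Proof.
by move=> a b; apply/compact_clopen_leP/idP => /basic_open_le.
Qed.

Lemma basic_compact_clopen_surj (K : compact_clopen (spectrum I)) :
  exists a, basic_compact_clopen a = K.
Proof.
have [a Ka] :=
  compact_open_basic (compact_clopen_compact K) (compact_clopen_clopen K).1.
by exists a; exact: compact_clopen_inj.
Qed.

End BasicCompactClopen.

Lemma compact_clopen_spectrum :
  naturally_isomorphic
    (functor_comp compact_clopen_functor spectrum_functor)
    (functor_id (opposite OGBPL)).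
Proof.
have inv (I : gbpl) : exists g, cancel g (@basic_compact_clopen I).
  by have [g gK] := choice (@basic_compact_clopen_surj I); exists g.
have iso (I : gbpl) g : cancel g (@basic_compact_clopen I) ->
    cancel (@basic_compact_clopen I) g /\
    @ogbpl_morphism I (compact_clopen_gbpl (spectrum I))
      (@basic_compact_clopen I) /\
    @ogbpl_morphism (compact_clopen_gbpl (spectrum I)) I g.
  move=> gK.
  have fle := @basic_compact_clopen_mono I.
  have fK : cancel (@basic_compact_clopen I) g.
    by move=> a; apply/eqP; rewrite eq_le -!fle gK lexx.
  have gle : {mono g : K L / (K <= L)%O} by move=> K L; rewrite -fle !gK.
  do 2 split=> //; first exact: (@order_isomorphism_ogbpl
    I (compact_clopen_gbpl (spectrum I)) _ _ fK gK fle).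
  exact: (@order_isomorphism_ogbpl
    (compact_clopen_gbpl (spectrum I)) I _ _ gK fK gle).
have eps_ogbpl (I : gbpl) : @ogbpl_morphism I
    (compact_clopen_gbpl (spectrum I)) (@basic_compact_clopen I).
  by have [g /iso[_ []]] := inv I.
exists (fun I => exist _ _ (eps_ogbpl I)); split=> [I J phi|I].
  by apply: concrete_hom_eq; apply/funext => a; exact: compact_clopen_inj.
have [g gK] := inv I; have [fK [_ morg]] := iso _ _ gK.
exists (exist _ g morg).
by split; apply: concrete_hom_eq; apply/funext => x; [exact: gK|exact: fK].
Qed.

Theorem corollary2p14 : dually_equivalent OPZLC OGBPL.
Proof.
exists compact_clopen_functor, spectrum_functor; split.
  exact: naturally_isomorphic_sym spectrum_compact_clopen.
exact: compact_clopen_spectrum.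
Qed.
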